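(* Let $G$ be a countable group and $\Lambda$ a $k$-graph. (a) If $c:\Lambda\to G$ is a functor, then $G$ acts freely on the skew product $G\times_c\Lambda$ by $g(h,\lambda)=(gh,\lambda)$, and $(G\times_c\Lambda)/G\cong\Lambda$. (b) If $G$ acts freely on $\Lambda$ with quotient $\Lambda/G$, then there is a functor $c:\Lambda/G\to G$ such that $\Lambda$ is isomorphic, as a $k$-graph and $G$-equivariantly, to $G\times_c(\Lambda/G)$ (with $G$ acting by $g(h,\lambda)=(gh,\lambda)$).
   Context: Let $\mathbf{N}=\{0,1,2,\dots\}$, $k\ge 1$, and order $\mathbf{N}^k$ coordinatewise. A $k$-graph $(\Lambda,d)$ is a countable small category $\Lambda$ (range map $r$, source map $s$) with a functor $d:\Lambda\to\mathbf{N}^k$ satisfying the factorisation property: if $d(\lambda)=m+n$ there are unique $\mu,\nu\in\Lambda$ with $\lambda=\mu\nu$, $d(\mu)=m$, $d(\nu)=n$. $\lambda\mu$ is defined iff $s(\lambda)=r(\mu)$. Put $\Lambda^n=d^{-1}(n)$; $\Lambda^0$ is identified with the set of objects. Standing assumption: $0<\#\{\lambda\in\Lambda^n:r(\lambda)=v\}<\infty$ for all $v\in\Lambda^0$, $n\in\mathbf{N}^k$. Morphisms of $k$-graphs are degree-preserving functors. $G$ acts on $\Lambda$ if there is a group homomorphism from $G$ to the group of automorphisms of the category $\Lambda$ preserving degree; the action is free if it is free on $\Lambda^0$. For a free action, $\Lambda/G$ is the quotient by $\lambda\sim\mu$ iff $\lambda=g\mu$ for some $g\in G$; all structure maps descend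 and $\Lambda/G$ is a $k$-graph. A functor $c:\Lambda\to G$ is a map with $c(\lambda\mu)=c(\lambda)c(\mu)$ for composable $\lambda,\mu$ and $c(v)=1$ for $v\in\Lambda^0$. The skew product $k$-graph $G\times_c\Lambda$ has objects $G\times\Lambda^0$, morphisms $G\times\Lambda$, $s(g,\lambda)=(gc(\lambda),s(\lambda))$, $r(g,\lambda)=(g,r(\lambda))$, $(g,\lambda)(gc(\lambda),\mu)=(g,\lambda\mu)$, and $d(g,\lambda)=d(\lambda)$. *)

(* Defs.v *)
From HB Require Import structures.
From mathcomp Require Import all_boot all_algebra.
From mathcomp Require Import boolp classical_sets functions cardinality.

Set Implicit Arguments.
Unset Strict Implicit.
Unset Printing Implicit Defensive.

Import GRing.Theory.
Local Open Scope classical_set_scope.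
Local Open Scope quotient_scope.

#[short(type="countGroupType")]
HB.structure Definition CountGroup := {G of Group G & Countable G}.

(* N^k, with its pointwise addition. *)
Notation degree k := {ffun 'I_k -> nat}.

(* Composition is a partial operation: comp x y is Some z exactly when x and y
   are composable, and z is then xy.  Objects are kept apart from morphisms;
   kg_fact forces idm to be a bijection from obj onto the morphisms of degree 0
   (lemma deg0_id below), so that obj is Lambda^0.  kg_nonempty and kg_finite
   say that 0 < #{l in Lambda^n : r(l) = v} < oo. *)
Record kgraph (k : nat) := KGraph {
  obj : countType;
  mor : countType;
  rng : mor -> obj;
  src : mor -> obj;
  idm : obj -> mor;
  comp : mor -> mor -> option mor;
  deg : mor -> degree k;
  kg_comp_def : forall x y, isSome (comp x y) = (src x == rng y);
  kg_rng_comp : forall x y z, comp x y = Some z -> rng z = rng x;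
  kg_src_comp : forall x y z, comp x y = Some z -> src z = src y;
  kg_rng_id : forall v, rng (idm v) = v;
  kg_src_id : forall v, src (idm v) = v;
  kg_id_l : forall x, comp (idm (rng x)) x = Some x;
  kg_id_r : forall x, comp x (idm (src x)) = Some x;
  kg_assoc : forall x y z xy yz,
    comp x y = Some xy -> comp y z = Some yz -> comp xy z = comp x yz;
  kg_deg_id : forall v, deg (idm v) = 0%R;
  kg_deg_comp : forall x y z, comp x y = Some z -> deg z = (deg x + deg y)%R;
  kg_fact : forall l m n, deg l = (m + n)%R ->
    exists! p : mor * mor,
      [/\ comp p.1 p.2 = Some l, deg p.1 = m & deg p.2 = n];
  kg_nonempty : forall v n, [set l | rng l = v /\ deg l = n] !=set0;
  kg_finite : forall v n, finite_set [set l | rng l = v /\ deg l = n]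
}.

Lemma deg0_id k (L : kgraph k) (x : mor L) : deg x = 0%R -> x = idm (rng x).
Proof.
move=> x0; have /(kg_fact (m := 0%R) (n := 0%R))[p [_ pU]] : deg x = (0 + 0)%R.
  by rewrite addr0.
have := pU (x, idm (src x)); rewrite /= kg_id_r kg_deg_id => /(_ (And3 erefl x0 erefl)).
have := pU (idm (rng x), x); rewrite /= kg_id_l kg_deg_id => /(_ (And3 erefl erefl x0)).
by move=> -> [].
Qed.

Record khom k (L M : kgraph k) := KHom {
  hobj : obj L -> obj M;
  hmor : mor L -> mor M;
  hom_rng : forall x, rng (hmor x) = hobj (rng x);
  hom_src : forall x, src (hmor x) = hobj (src x);
  hom_id : forall v, hmor (idm v) = idm (hobj v);
  hom_comp : forall x y z,
    comp x y = Some z -> comp (hmor x) (hmor y) = Some (hmor z);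
  hom_deg : forall x, deg (hmor x) = deg x
}.

Definition is_iso k (L M : kgraph k) (f : khom L M) : Prop :=
  exists g : khom M L,
    [/\ cancel (hobj f) (hobj g), cancel (hobj g) (hobj f),
        cancel (hmor f) (hmor g) & cancel (hmor g) (hmor f)].

Definition isomorphic k (L M : kgraph k) : Prop :=
  exists f : khom L M, is_iso f.

(* A group homomorphism from G to the group of automorphisms of L. *)
Record action (G : countGroupType) k (L : kgraph k) := Action {
  act :> G -> khom L L;
  act_aut : forall g, is_iso (act g);
  act_objM : forall g h v, hobj (act (g * h)%g) v = hobj (act g) (hobj (act h) v);
  act_morM : forall g h x, hmor (act (g * h)%g) x = hmor (act g) (hmor (act h) x)
}.

Definition is_free (G : countGroupType) k (L : kgraph k) (A : action G L) : Prop :=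
  forall g v, hobj (A g) v = v -> g = 1%g.

Definition equivariant (G : countGroupType) k (L M : kgraph k)
    (A : action G L) (B : action G M) (f : khom L M) : Prop :=
  (forall g v, hobj f (hobj (A g) v) = hobj (B g) (hobj f v)) /\
  (forall g x, hmor f (hmor (A g) x) = hmor (B g) (hmor f x)).

Record gfunctor (G : countGroupType) k (L : kgraph k) := GFunctor {
  gfun :> mor L -> G;
  gfun_comp : forall x y z, comp x y = Some z -> gfun z = (gfun x * gfun y)%g;
  gfun_id : forall v, gfun (idm v) = 1%g
}.

Section Skew.
Variables (G : countGroupType) (k : nat) (L : kgraph k) (c : gfunctor G L).

Let sobj : countType := (G * obj L)%type.
Let smor : countType := (G * mor L)%type.

Definition skew_rng (x : smor) : sobj := (x.1, rng x.2).
Definition skew_src (x : smor) : sobj := ((x.1 * c x.2)%g, src x.2).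
Definition skew_id (v : sobj) : smor := (v.1, idm v.2).
Definition skew_comp (x y : smor) : option smor :=
  if y.1 == (x.1 * c x.2)%g then omap (pair x.1) (comp x.2 y.2) else None.
Definition skew_deg (x : smor) : degree k := deg x.2.

Lemma skew_compP x y z : skew_comp x y = Some z <->
  [/\ y.1 = (x.1 * c x.2)%g, z.1 = x.1 & comp x.2 y.2 = Some z.2].
Proof.
rewrite /skew_comp; case: eqP => [e|ne]; last by split => // -[].
case: (comp x.2 y.2) => [w|] /=; last by split=> // -[].
split=> [[<-]//|[_ <- [->]]]; by case: z.
Qed.

Lemma skew_comp_def x y : isSome (skew_comp x y) = (skew_src x == skew_rng y).
Proof.
rewrite /skew_comp /skew_src /skew_rng xpair_eqE eq_sym -kg_comp_def.
by case: eqP => //= _; case: comp.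
Qed.

Lemma skew_rng_comp x y z : skew_comp x y = Some z -> skew_rng z = skew_rng x.
Proof. by move/skew_compP=> [_ e /kg_rng_comp e']; rewrite /skew_rng e e'. Qed.

Lemma skew_src_comp x y z : skew_comp x y = Some z -> skew_src z = skew_src y.
Proof.
move/skew_compP=> [e1 e2 e]; rewrite /skew_src e1 e2.
by rewrite (gfun_comp c e) (kg_src_comp e) mulgA.
Qed.

Lemma skew_rng_id v : skew_rng (skew_id v) = v.
Proof. by case: v => g v; rewrite /skew_rng /= kg_rng_id. Qed.

Lemma skew_src_id v : skew_src (skew_id v) = v.
Proof. by case: v => g v; rewrite /skew_src /= kg_src_id gfun_id mulg1. Qed.

Lemma skew_id_l x : skew_comp (skew_id (skew_rng x)) x = Some x.
Proof. by apply/skew_compP; rewrite /= gfun_id mulg1 kg_id_l. Qed.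

Lemma skew_id_r x : skew_comp x (skew_id (skew_src x)) = Some x.
Proof. by apply/skew_compP; rewrite /= kg_id_r. Qed.

Lemma skew_assoc x y z xy yz : skew_comp x y = Some xy ->
  skew_comp y z = Some yz -> skew_comp xy z = skew_comp x yz.
Proof.
move=> /skew_compP[e1 e2 e] /skew_compP[f1 f2 f].
rewrite /skew_comp f1 f2 e1 e2 (gfun_comp c e) mulgA !eqxx.
by rewrite (kg_assoc e f).
Qed.

Lemma skew_deg_id v : skew_deg (skew_id v) = 0%R.
Proof. exact: kg_deg_id. Qed.

Lemma skew_deg_comp x y z :
  skew_comp x y = Some z -> skew_deg z = (skew_deg x + skew_deg y)%R.
Proof. by move/skew_compP=> [_ _ /kg_deg_comp]. Qed.

Lemma skew_fact l m n : skew_deg l = (m + n)%R ->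
  exists! p : smor * smor,
    [/\ skew_comp p.1 p.2 = Some l, skew_deg p.1 = m & skew_deg p.2 = n].
Proof.
move=> /kg_fact[[a b] [/= [ab am bn] U]].
exists ((l.1, a), ((l.1 * c a)%g, b)); split.
  by split=> //; apply/skew_compP.
case=> -[g a'] [h b'] /= [/skew_compP[/= -> <- ab'] am' bn'].
by have [-> ->] := U (a', b') (And3 ab' am' bn').
Qed.

Lemma skew_nonempty v n : [set l | skew_rng l = v /\ skew_deg l = n] !=set0.
Proof.
case: v => g v; have [l [lv ln]] := kg_nonempty v n.
by exists (g, l); rewrite /skew_rng /= lv.
Qed.

Lemma skew_finite v n : finite_set [set l | skew_rng l = v /\ skew_deg l = n].
Proof.
apply: (sub_finite_set _ (finite_image (pair v.1) (kg_finite v.2 n))).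
by move=> [g l] /= [<- ln]; exists l.
Qed.

Definition skew : kgraph k :=
  KGraph skew_comp_def skew_rng_comp skew_src_comp skew_rng_id skew_src_id
    skew_id_l skew_id_r skew_assoc skew_deg_id skew_deg_comp skew_fact
    skew_nonempty skew_finite.

End Skew.

Definition is_left_translation (G : countGroupType) k (L : kgraph k)
    (c : gfunctor G L) (A : action G (skew c)) : Prop :=
  (forall g h (v : obj L), hobj (A g) (h, v) = ((g * h)%g, v)) /\
  (forall g h (x : mor L), hmor (A g) (h, x) = ((g * h)%g, x)).

Section ActionTheory.
Variables (G : countGroupType) (k : nat) (L : kgraph k) (A : action G L).

Lemma act_obj1 v : hobj (A 1%g) v = v.
Proof.
have [f [/can_inj i _ _ _]] := act_aut A 1%g.
by apply: i; rewrite -act_objM mulg1.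
Qed.

Lemma act_mor1 x : hmor (A 1%g) x = x.
Proof.
have [f [_ _ /can_inj i _]] := act_aut A 1%g.
by apply: i; rewrite -act_morM mulg1.
Qed.

Lemma act_objK g : cancel (hobj (A g)) (hobj (A g^-1%g)).
Proof. by move=> v; rewrite -act_objM mulVg act_obj1. Qed.

Lemma act_morK g : cancel (hmor (A g)) (hmor (A g^-1%g)).
Proof. by move=> x; rewrite -act_morM mulVg act_mor1. Qed.

Definition orbit_obj : rel (obj L) := fun v w => `[< exists g, v = hobj (A g) w >].
Definition orbit_mor : rel (mor L) := fun x y => `[< exists g, x = hmor (A g) y >].

Lemma orbit_obj_equiv : equiv_class_of orbit_obj.
Proof.
split=> [v|v w|v u w].
- by apply/asboolP; exists 1%g; rewrite act_obj1.
- by apply/asboolP/asboolP => -[g ->]; exists g^-1%g; rewrite act_objK.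
- move=> /asboolP[g ->] /asboolP[h ->].
  by apply/asboolP; exists (g * h)%g; rewrite act_objM.
Qed.

Lemma orbit_mor_equiv : equiv_class_of orbit_mor.
Proof.
split=> [v|v w|v u w].
- by apply/asboolP; exists 1%g; rewrite act_mor1.
- by apply/asboolP/asboolP => -[g ->]; exists g^-1%g; rewrite act_morK.
- move=> /asboolP[g ->] /asboolP[h ->].
  by apply/asboolP; exists (g * h)%g; rewrite act_morM.
Qed.

Canonical orbit_obj_rel := EquivRelPack orbit_obj_equiv.
Canonical orbit_mor_rel := EquivRelPack orbit_mor_equiv.

Definition qobj := {eq_quot orbit_obj}.
Definition qmor := {eq_quot orbit_mor}.
HB.instance Definition _ := EqQuotient.on qobj.
HB.instance Definition _ := EqQuotient.on qmor.
HB.instance Definition _ := [Countable of qobj by <:%/].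
HB.instance Definition _ := [Countable of qmor by <:%/].

Lemma qobjP v w : \pi_qobj v = \pi_qobj w <-> exists g, v = hobj (A g) w.
Proof.
by split=> [/eqquotP/asboolP//|e]; apply/eqquotP/asboolP.
Qed.

Lemma qmorP x y : \pi_qmor x = \pi_qmor y <-> exists g, x = hmor (A g) y.
Proof.
by split=> [/eqquotP/asboolP//|e]; apply/eqquotP/asboolP.
Qed.

Lemma qmor_act g x : \pi_qmor (hmor (A g) x) = \pi_qmor x.
Proof. by apply/qmorP; exists g. Qed.

Lemma qobj_act g v : \pi_qobj (hobj (A g) v) = \pi_qobj v.
Proof. by apply/qobjP; exists g. Qed.

Lemma act_comp g x y z :
  comp (hmor (A g) x) (hmor (A g) y) = Some (hmor (A g) z) <-> comp x y = Some z.
Proof.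
split=> [|/(hom_comp (A g))//].
by move/(hom_comp (A g^-1%g)); rewrite !act_morK.
Qed.

Definition qrng (X : qmor) : qobj := \pi_qobj (rng (repr X)).
Definition qsrc (X : qmor) : qobj := \pi_qobj (src (repr X)).
Definition qid (V : qobj) : qmor := \pi_qmor (idm (repr V)).
Definition qdeg (X : qmor) : degree k := deg (repr X).
(* [x][y] = [z] whenever xy = z; None when no such representatives exist. *)
Definition qcomp (X Y : qmor) : option qmor :=
  xget None [set o | exists x y z, [/\ comp x y = Some z, X = \pi_qmor x,
                                       Y = \pi_qmor y & o = Some (\pi_qmor z)]].

Lemma qrngE x : qrng (\pi_qmor x) = \pi_qobj (rng x).
Proof.
have /qmorP[g e] : \pi_qmor (repr (\pi_qmor x)) = \pi_qmor x by rewrite reprK.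
by rewrite /qrng e hom_rng qobj_act.
Qed.

Lemma qsrcE x : qsrc (\pi_qmor x) = \pi_qobj (src x).
Proof.
have /qmorP[g e] : \pi_qmor (repr (\pi_qmor x)) = \pi_qmor x by rewrite reprK.
by rewrite /qsrc e hom_src qobj_act.
Qed.

Lemma qidE v : qid (\pi_qobj v) = \pi_qmor (idm v).
Proof.
have /qobjP[g e] : \pi_qobj (repr (\pi_qobj v)) = \pi_qobj v by rewrite reprK.
by rewrite /qid e -hom_id qmor_act.
Qed.

Lemma qdegE x : qdeg (\pi_qmor x) = deg x.
Proof.
have /qmorP[g e] : \pi_qmor (repr (\pi_qmor x)) = \pi_qmor x by rewrite reprK.
by rewrite /qdeg e hom_deg.
Qed.

Hypothesis F : is_free A.

Lemma free_inj g h v : hobj (A g) v = hobj (A h) v -> g = h.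
Proof.
move=> e; apply: (mulgI h^-1%g); rewrite mulVg.
by apply: (F (v := v)); rewrite act_objM e act_objK.
Qed.

Lemma qcompP X Y Z : qcomp X Y = Some Z <->
  exists x y z, [/\ comp x y = Some z, X = \pi_qmor x,
                    Y = \pi_qmor y & Z = \pi_qmor z].
Proof.
rewrite /qcomp; split.
  by case: xgetP => // o -> [x [y [z [xy eX eY ->]]]] [<-]; exists x, y, z.
move=> [x [y [z [xy eX eY eZ]]]].
apply: xget_unique; first by exists x, y, z; rewrite eZ.
move=> o [x' [y' [z' [xy' eX' eY' ->]]]]; congr Some; rewrite eZ.
move: eX' eY'; rewrite eX eY => /esym/qmorP[g ex] /esym/qmorP[h ey].
have/eqP sx : src x == rng y by rewrite -kg_comp_def xy.
have : src x' == rng y' by rewrite -kg_comp_def xy'.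
rewrite ex ey hom_src hom_rng sx => /eqP/free_inj gh.
have := hom_comp (A g) xy; rewrite {2}gh -ex -ey xy' => -[->].
by rewrite qmor_act.
Qed.

Lemma qcompE x y z : comp x y = Some z ->
  qcomp (\pi_qmor x) (\pi_qmor y) = Some (\pi_qmor z).
Proof. by move=> xy; apply/qcompP; exists x, y, z. Qed.

Lemma q_comp_def X Y : isSome (qcomp X Y) = (qsrc X == qrng Y).
Proof.
apply/idP/eqP.
  case E: (qcomp X Y) => [Z|] // _.
  have [x [y [z [xy -> -> _]]]] := (qcompP _ _ _).1 E.
  by rewrite qsrcE qrngE; congr \pi; apply/eqP; rewrite -kg_comp_def xy.
elim/quotW: X => x; elim/quotW: Y => y; rewrite qsrcE qrngE => /qobjP[g e].
have : isSome (comp x (hmor (A g) y)) by rewrite kg_comp_def hom_rng e.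
by case E: comp => [z|] // _; rewrite -(qmor_act g y) (qcompE E).
Qed.

Lemma q_rng_comp X Y Z : qcomp X Y = Some Z -> qrng Z = qrng X.
Proof.
by move/qcompP=> [x [y [z [/kg_rng_comp e -> _ ->]]]]; rewrite !qrngE e.
Qed.

Lemma q_src_comp X Y Z : qcomp X Y = Some Z -> qsrc Z = qsrc Y.
Proof.
by move/qcompP=> [x [y [z [/kg_src_comp e _ -> ->]]]]; rewrite !qsrcE e.
Qed.

Lemma q_rng_id V : qrng (qid V) = V.
Proof. by elim/quotW: V => v; rewrite qidE qrngE kg_rng_id. Qed.

Lemma q_src_id V : qsrc (qid V) = V.
Proof. by elim/quotW: V => v; rewrite qidE qsrcE kg_src_id. Qed.

Lemma q_id_l X : qcomp (qid (qrng X)) X = Some X.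
Proof.
elim/quotW: X => x; rewrite qrngE qidE; exact/qcompE/kg_id_l.
Qed.

Lemma q_id_r X : qcomp X (qid (qsrc X)) = Some X.
Proof.
elim/quotW: X => x; rewrite qsrcE qidE; exact/qcompE/kg_id_r.
Qed.

Lemma q_assoc X Y Z XY YZ :
  qcomp X Y = Some XY -> qcomp Y Z = Some YZ -> qcomp XY Z = qcomp X YZ.
Proof.
move=> /qcompP[x [y [w [xy -> -> ->]]]] /qcompP[y' [z [u [yz e -> ->]]]].
move/qmorP: e => [g e].
have {}yz : comp y (hmor (A g) z) = Some (hmor (A g) u) by rewrite e act_comp.
rewrite -(qmor_act g z) -(qmor_act g u).
have : isSome (comp w (hmor (A g) z)).
  by rewrite kg_comp_def (kg_src_comp xy) -kg_comp_def yz.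
case E: comp => [t|] // _; rewrite (qcompE E).
by rewrite (kg_assoc xy yz) in E; rewrite (qcompE E).
Qed.

Lemma q_deg_id V : qdeg (qid V) = 0%R.
Proof. by elim/quotW: V => v; rewrite qidE qdegE kg_deg_id. Qed.

Lemma q_deg_comp X Y Z : qcomp X Y = Some Z -> qdeg Z = (qdeg X + qdeg Y)%R.
Proof.
by move/qcompP=> [x [y [z [/kg_deg_comp e -> -> ->]]]]; rewrite !qdegE.
Qed.

Lemma q_fact X m n : qdeg X = (m + n)%R ->
  exists! p : qmor * qmor,
    [/\ qcomp p.1 p.2 = Some X, qdeg p.1 = m & qdeg p.2 = n].
Proof.
elim/quotW: X => x; rewrite qdegE => /kg_fact[[a b] [/= [ab am bn] U]].
exists (\pi_qmor a, \pi_qmor b); split; first by rewrite /= !qdegE (qcompE ab).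
case=> P Q /= [/qcompP[p [q [z [pq -> -> /qmorP[g e]]]]]].
rewrite !qdegE => pm qn; rewrite -(qmor_act g p) -(qmor_act g q).
have gpq : comp (hmor (A g) p) (hmor (A g) q) = Some x by rewrite e act_comp.
have /= := U (_, _) (And3 gpq _ _); rewrite /= !hom_deg.
by case/(_ pm qn) => <- <-.
Qed.

Lemma q_nonempty V n : [set X | qrng X = V /\ qdeg X = n] !=set0.
Proof.
elim/quotW: V => v; have [x [xv xn]] := kg_nonempty v n.
by exists (\pi_qmor x); rewrite /= qrngE qdegE xv.
Qed.

Lemma q_finite V n : finite_set [set X | qrng X = V /\ qdeg X = n].
Proof.
elim/quotW: V => v.
apply: (sub_finite_set _ (finite_image (\pi_qmor) (kg_finite v n))) => X /=.
elim/quotW: X => x; rewrite qrngE qdegE => -[/esym/qobjP[g e] xn].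
by exists (hmor (A g) x); rewrite ?qmor_act // hom_rng hom_deg e.
Qed.

Definition quotient_graph : kgraph k :=
  KGraph q_comp_def q_rng_comp q_src_comp q_rng_id q_src_id
    q_id_l q_id_r q_assoc q_deg_id q_deg_comp q_fact q_nonempty q_finite.

End ActionTheory.

(* Main.v *)
Require Import Defs.
From mathcomp Require Import all_boot.
From mathcomp Require Import boolp.

(** Both parts rest on the same picture: a free action makes the vertices of a
    graph into a disjoint union of copies of G, one for each orbit, and a skew
    product is such a graph together with a base point in every copy.

    For (a), left translation on the skew product leaves the second coordinate
    alone, so the projection onto L descends to the quotient ([descend]); it is
    bijective there because (h, x) is the translate by h of (1, x).

    For (b), choose a base point in every orbit of vertices.  By freeness, each
    vertex v is the translate of the base point of its orbit by a unique element
    of G, the position of v, and moving v by h multiplies its position on the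
    left by h ([position_act]).  The element

      position (rng x)^-1 * position (src x)

    therefore depends only on the orbit of x, and it is multiplicative because
    the middle terms telescope.  This is the functor c ([cocycle]).  Sending v to
    (position v, orbit of v) and x to (position (rng x), orbit of x) respects
    sources exactly because of the choice of c, and it is bijective because a
    position and an orbit determine one vertex, hence also one morphism
    ([coordinates_iso]). *)

Set Implicit Arguments.
Unset Strict Implicit.
Unset Printing Implicit Defensive.

Local Open Scope group_scope.
Local Open Scope quotient_scope.

(* Composition in a graph, rather than composition of functions. *)
Local Notation comp := Defs.comp.

(** * Bijective morphisms and morphisms out of a quotient *)

Section BijectiveHom.
Variables (k : nat) (L M : kgraph k) (f : khom L M).
Variables (go : obj M -> obj L) (gm : mor M -> mor L).
Hypotheses (foK : cancel (hobj f) go) (goK : cancel go (hobj f)).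
Hypotheses (fmK : cancel (hmor f) gm) (gmK : cancel gm (hmor f)).

Lemma inv_rng x : rng (gm x) = go (rng x).
Proof. by rewrite -{2}(gmK x) hom_rng foK. Qed.

Lemma inv_src x : src (gm x) = go (src x).
Proof. by rewrite -{2}(gmK x) hom_src foK. Qed.

Lemma inv_id v : gm (idm v) = idm (go v).
Proof. by rewrite -{1}(goK v) -hom_id fmK. Qed.

Lemma inv_comp x y z :
  comp x y = Some z -> comp (gm x) (gm y) = Some (gm z).
Proof.
move=> xy; have : isSome (comp (gm x) (gm y)).
  by rewrite kg_comp_def inv_src inv_rng (inj_eq (can_inj goK)) -kg_comp_def xy.
case E: comp => [w|] // _.
by move/(hom_comp f): E; rewrite !gmK xy => -[->]; rewrite fmK.
Qed.

Lemma inv_deg x : deg (gm x) = deg x.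
Proof. by rewrite -(hom_deg f) gmK. Qed.

(** The inverse needs no separate verification: f reflects composability, since
    it is injective on objects. *)
Lemma bijective_iso : is_iso f.
Proof. by exists (KHom inv_rng inv_src inv_id inv_comp inv_deg). Qed.

End BijectiveHom.

Section Descend.
Variables (G : countGroupType) (k : nat) (L M : kgraph k) (A : action G L).
Variables (F : is_free A) (f : khom L M).
Hypothesis obj_inv : forall g v, hobj f (hobj (A g) v) = hobj f v.
Hypothesis mor_inv : forall g x, hmor f (hmor (A g) x) = hmor f x.

Definition descend_obj (V : obj (quotient_graph F)) : obj M :=
  hobj f (repr (V : qobj A)).
Definition descend_mor (X : mor (quotient_graph F)) : mor M :=
  hmor f (repr (X : qmor A)).

Lemma descend_objE v : descend_obj (\pi_(qobj A) v) = hobj f v.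
Proof.
rewrite /descend_obj; case/qobjP: (reprK (\pi_(qobj A) v)) => g ->.
exact: obj_inv.
Qed.

Lemma descend_morE x : descend_mor (\pi_(qmor A) x) = hmor f x.
Proof.
rewrite /descend_mor; case/qmorP: (reprK (\pi_(qmor A) x)) => g ->.
exact: mor_inv.
Qed.

Lemma descend_rng X : rng (descend_mor X) = descend_obj (rng X).
Proof.
by elim/quotW: X => x; rewrite descend_morE hom_rng /= qrngE descend_objE.
Qed.

Lemma descend_src X : src (descend_mor X) = descend_obj (src X).
Proof.
by elim/quotW: X => x; rewrite descend_morE hom_src /= qsrcE descend_objE.
Qed.

Lemma descend_id V : descend_mor (idm V) = idm (descend_obj V).
Proof.
by elim/quotW: V => v; rewrite /= qidE descend_morE hom_id descend_objE.
Qed.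

Lemma descend_comp X Y Z :
  comp X Y = Some Z -> comp (descend_mor X) (descend_mor Y) = Some (descend_mor Z).
Proof.
move=> /(qcompP F)[x [y [z [xy -> -> ->]]]].
by rewrite !descend_morE; apply: hom_comp.
Qed.

Lemma descend_deg X : deg (descend_mor X) = deg X.
Proof. by elim/quotW: X => x; rewrite descend_morE hom_deg /= qdegE. Qed.

(** The universal property of the quotient, for an invariant morphism f. *)
Definition descend : khom (quotient_graph F) M :=
  KHom descend_rng descend_src descend_id descend_comp descend_deg.

End Descend.

(** * Left translation on a skew product *)

Section LeftTranslation.
Variables (G : countGroupType) (k : nat) (L : kgraph k) (c : gfunctor G L).

Definition translate T (g : G) (x : G * T) : G * T := (g * x.1, x.2).

Lemma translateK T (g : G) : cancel (@translate T g) (translate g^-1).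
Proof. by case=> h x; rewrite /translate /= mulKg. Qed.

Lemma translateVK T (g : G) : cancel (@translate T g^-1) (translate g).
Proof. by case=> h x; rewrite /translate /= mulVKg. Qed.

Lemma translateM T (g h : G) (x : G * T) :
  translate (g * h) x = translate g (translate h x).
Proof. by rewrite /translate /= mulgA. Qed.

Section TranslateHom.
Variable g : G.
Let to (v : obj (skew c)) : obj (skew c) := translate g v.
Let tm (x : mor (skew c)) : mor (skew c) := translate g x.

Lemma translate_rng x : rng (tm x) = to (rng x).
Proof. by []. Qed.

Lemma translate_src x : src (tm x) = to (src x).
Proof. by rewrite /tm /to /translate /= /skew_src /= mulgA. Qed.

Lemma translate_id v : tm (idm v) = idm (to v).
Proof. by []. Qed.

Lemma translate_comp x y z : comp x y = Some z -> comp (tm x) (tm y) = Some (tm z).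
Proof.
move=> /skew_compP[e1 e2 e]; apply/skew_compP.
by rewrite /tm /translate /= e1 e2 mulgA.
Qed.

Lemma translate_deg x : deg (tm x) = deg x.
Proof. by []. Qed.

Definition translate_hom : khom (skew c) (skew c) :=
  KHom translate_rng translate_src translate_id translate_comp translate_deg.

Lemma translate_iso : is_iso translate_hom.
Proof.
exact: (bijective_iso (f := translate_hom) (@translateK (obj L) g)
          (@translateVK (obj L) g) (@translateK (mor L) g) (@translateVK (mor L) g)).
Qed.

End TranslateHom.

Definition translation : action G (skew c) :=
  Action translate_iso (fun g h v => translateM g h v)
    (fun g h x => translateM g h x).

Lemma translationP : is_left_translation translation.
Proof. by []. Qed.

Lemma translation_free : is_free translation.
Proof. by move=> g [h v] [e]; apply: (mulIg h); rewrite mul1g. Qed.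

Lemma proj_comp (x y z : mor (skew c)) :
  comp x y = Some z -> comp x.2 y.2 = Some z.2.
Proof. by case/skew_compP. Qed.

Definition proj : khom (skew c) L :=
  @KHom _ (skew c) L snd snd (fun=> erefl) (fun=> erefl) (fun=> erefl) proj_comp
    (fun=> erefl).

Lemma proj_act_obj g v : hobj proj (hobj (translation g) v) = hobj proj v.
Proof. by []. Qed.

Lemma proj_act_mor g x : hmor proj (hmor (translation g) x) = hmor proj x.
Proof. by []. Qed.

Let Q : kgraph k := quotient_graph translation_free.
Definition base_obj (v : obj L) : obj Q :=
  \pi_(qobj translation) ((1, v) : obj (skew c)).
Definition base_mor (x : mor L) : mor Q :=
  \pi_(qmor translation) ((1, x) : mor (skew c)).

Lemma quotient_translation : isomorphic Q L.
Proof.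
exists (descend translation_free proj_act_obj proj_act_mor).
apply: (bijective_iso (go := base_obj) (gm := base_mor)).
- elim/quotW => -[g v]; rewrite [hobj _ _](descend_objE _ proj_act_obj).
  by apply/qobjP; exists g^-1; rewrite /= /translate /= mulVg.
- by move=> v; rewrite [hobj _ _](descend_objE _ proj_act_obj).
- elim/quotW => -[g x]; rewrite [hmor _ _](descend_morE _ proj_act_mor).
  by apply/qmorP; exists g^-1; rewrite /= /translate /= mulVg.
- by move=> x; rewrite [hmor _ _](descend_morE _ proj_act_mor).
Qed.

End LeftTranslation.

(** * Coordinates for a free action *)

Section Coordinates.
Variables (G : countGroupType) (k : nat) (L : kgraph k) (A : action G L).
Hypothesis F : is_free A.

Let Q : kgraph k := quotient_graph F.

Lemma position_exists v : exists g, v = hobj (A g) (repr (\pi_(qobj A) v)).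
Proof. by apply/qobjP; rewrite reprK. Qed.

(** The base point of an orbit is its canonical representative. *)
Definition position (v : obj L) : G := projT1 (cid (position_exists v)).

Lemma positionP v : hobj (A (position v)) (repr (\pi_(qobj A) v)) = v.
Proof. by rewrite /position; case: cid => g /= <-. Qed.

(** This is where freeness enters: both sides carry the base point of the orbit
    to the same vertex. *)
Lemma position_act g v : position (hobj (A g) v) = g * position v.
Proof.
apply: (free_inj F (v := repr (\pi_(qobj A) v))).
by rewrite act_objM positionP -(qobj_act A g v) positionP.
Qed.

Lemma position_repr (V : qobj A) : position (repr V) = 1.
Proof. by apply: (F (v := repr V)); rewrite -{2}(reprK V) positionP. Qed.

Definition cocycle_fun (X : mor Q) : G :=
  (position (rng (repr (X : qmor A))))^-1 * position (src (repr (X : qmor A))).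

Lemma cocycleE x :
  cocycle_fun (\pi_(qmor A) x) = (position (rng x))^-1 * position (src x).
Proof.
rewrite /cocycle_fun; case/qmorP: (reprK (\pi_(qmor A) x)) => g ->.
by rewrite hom_rng hom_src !position_act invgM -mulgA mulKg.
Qed.

Lemma cocycle_comp X Y Z :
  comp X Y = Some Z -> cocycle_fun Z = cocycle_fun X * cocycle_fun Y.
Proof.
move=> /(qcompP F)[x [y [z [xy -> -> ->]]]]; rewrite !cocycleE.
have /eqP -> : src x == rng y by rewrite -kg_comp_def xy.
by rewrite (kg_rng_comp xy) (kg_src_comp xy) -mulgA mulVKg.
Qed.

Lemma cocycle_id V : cocycle_fun (idm V) = 1.
Proof.
by elim/quotW: V => v; rewrite /= qidE cocycleE kg_rng_id kg_src_id mulVg.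
Qed.

Definition cocycle : gfunctor G Q := GFunctor cocycle_comp cocycle_id.

Definition coord_obj (v : obj L) : obj (skew cocycle) :=
  (position v, \pi_(qobj A) v).
Definition coord_mor (x : mor L) : mor (skew cocycle) :=
  (position (rng x), \pi_(qmor A) x).

Lemma coord_rng x : rng (coord_mor x) = coord_obj (rng x).
Proof. by rewrite /= /skew_rng /= qrngE. Qed.

Lemma coord_src x : src (coord_mor x) = coord_obj (src x).
Proof. by rewrite /= /skew_src /= cocycleE mulVKg qsrcE. Qed.

Lemma coord_id v : coord_mor (idm v) = idm (coord_obj v).
Proof. by rewrite /= /skew_id /= qidE /coord_mor kg_rng_id. Qed.

Lemma coord_comp x y z :
  comp x y = Some z -> comp (coord_mor x) (coord_mor y) = Some (coord_mor z).
Proof.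
move=> xy; apply/skew_compP; rewrite /= cocycleE mulVKg (kg_rng_comp xy).
have /eqP -> : src x == rng y by rewrite -kg_comp_def xy.
by split=> //; apply: qcompE.
Qed.

Lemma coord_deg x : deg (coord_mor x) = deg x.
Proof. exact: qdegE. Qed.

Definition coordinates : khom L (skew cocycle) :=
  KHom coord_rng coord_src coord_id coord_comp coord_deg.

Definition uncoord_obj (v : obj (skew cocycle)) : obj L :=
  hobj (A v.1) (repr (v.2 : qobj A)).

(** The morphism of the orbit x.2 whose range has position x.1: the chosen
    representative must first be moved so that its range has position 1. *)
Definition uncoord_mor (x : mor (skew cocycle)) : mor L :=
  let y := repr (x.2 : qmor A) in hmor (A (x.1 * (position (rng y))^-1)) y.

Lemma coord_objK : cancel coord_obj uncoord_obj.
Proof. exact: positionP. Qed.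

Lemma uncoord_objK : cancel uncoord_obj coord_obj.
Proof.
case=> g V; rewrite /coord_obj /uncoord_obj /=.
by rewrite position_act position_repr mulg1 qobj_act reprK.
Qed.

Lemma coord_morK : cancel coord_mor uncoord_mor.
Proof.
move=> x; rewrite /uncoord_mor /=.
have /qmorP[g e] : \pi_(qmor A) x = \pi_(qmor A) (repr (\pi_(qmor A) x)).
  by rewrite reprK.
by rewrite {1}e hom_rng position_act mulgK -e.
Qed.

Lemma uncoord_morK : cancel uncoord_mor coord_mor.
Proof.
case=> g X; rewrite /coord_mor /uncoord_mor /=.
by rewrite hom_rng position_act mulgVK qmor_act reprK.
Qed.

Lemma coordinates_iso : is_iso coordinates.
Proof.
exact: (bijective_iso (f := coordinates) coord_objK uncoord_objK
          coord_morK uncoord_morK).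
Qed.

Lemma coordinates_equivariant : equivariant A (translation cocycle) coordinates.
Proof.
split=> [g v|g x] /=; rewrite /translate /=.
  by rewrite /coord_obj position_act qobj_act.
by rewrite /coord_mor hom_rng position_act qmor_act.
Qed.

End Coordinates.

Theorem mainTheorem12 (k : nat) (k_gt0 : (0 < k)%N)
    (G : countGroupType) (L : kgraph k) :
  (forall c : gfunctor G L,
     exists A : action G (skew c),
       is_left_translation A /\
       exists F : is_free A, isomorphic (quotient_graph F) L)
  /\
  (forall (A : action G L) (F : is_free A),
     exists (c : gfunctor G (quotient_graph F)) (B : action G (skew c)),
       is_left_translation B /\
       exists f : khom L (skew c), is_iso f /\ equivariant A B f).
Proof.
split=> [c|A F].
  exists (translation c); split; first exact: translationP.
  by exists (translation_free (c := c)); apply: quotient_translation.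
exists (cocycle F), (translation (cocycle F)); split; first exact: translationP.
exists (coordinates F); split; first exact: coordinates_iso.
exact: coordinates_equivariant.
Qed.
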